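(* Let $\mathcal{C}$ be an equational class of algebras of the same type, $A$ and $B$ algebras from $\mathcal{C}$ and $f:A\to B$ a morphism in $\mathcal{C}$. For $\theta\in\mathrm{Con}(A)$, let $f_{(\theta)}:A/\theta\to B/Cg_B(f(\theta))$ be the morphism defined by $f_{(\theta)}(a/\theta)=f(a)/Cg_B(f(\theta))$ for all $a\in A$. Then: (1) if $\mathcal{C}$ is congruence-modular, $f$ is admissible iff, for any $\theta\in\mathrm{Con}(A)$, $f_{(\theta)}$ is admissible; (2) $f$ is Max-admissible iff, for any $\theta\in\mathrm{Con}(A)$, $f_{(\theta)}$ is Max-admissible.
   Context: All algebras are non-empty. For an algebra $M$, $\mathrm{Con}(M)$ is the lattice of congruences of $M$, ordered by inclusion, with greatest element $\nabla_M=M^2$ and join $\vee$; $\mathrm{Max}(M)$ is the set of maximal elements of $\mathrm{Con}(M)\setminus\{\nabla_M\}$. For $X\subseteq M^2$, $Cg_M(X)$ is the congruence of $M$ generated by $X$. An equational class is congruence-modular if $\mathrm{Con}(M)$ is a modular lattice for each of its members $M$. For a morphism $g:M\to N$, $\alpha\in\mathrm{Con}(M)$ and $\psi\in\mathrm{Con}(N)$, put $g(\alpha)=\{(g(a),g(b)) : (a,b)\in\alpha\}\subseteq N^2$, $g^*(\psi)=\{(a,b)\in M^2 : (g(a),g(b))\in\psi\}\in\mathrm{Con}(M)$ and $\mathrm{Ker}(g)=\{(a,b)\in M^2 : g(a)=g(b)\}$. If $\mathcal{C}$ is congruence-modular, the commutators $[\cdot,\cdot]_M$ of the members $M$ of $\mathcal{C}$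 are the uniquely determined binary operations on $\mathrm{Con}(M)$ such that, for all $\alpha,\beta\in\mathrm{Con}(M)$, $[\alpha,\beta]_M$ is the least $\mu\in\mathrm{Con}(M)$ such that $\mu\subseteq\alpha\cap\beta$ and, for every algebra $N$ in $\mathcal{C}$ and every surjective morphism $h:M\to N$, $\mu\vee\mathrm{Ker}(h)=h^*([h(\alpha\vee\mathrm{Ker}(h)),h(\beta\vee\mathrm{Ker}(h))]_N)$. In that case, a congruence $\phi\neq\nabla_M$ of $M$ is prime if, for all $\alpha,\beta\in\mathrm{Con}(M)$, $[\alpha,\beta]_M\subseteq\phi$ implies $\alpha\subseteq\phi$ or $\beta\subseteq\phi$; $\mathrm{Spec}(M)$ is the set of prime congruences of $M$. A morphism $g:M\to N$ in a congruence-modular $\mathcal{C}$ is admissible if $g^*(\psi)\in\mathrm{Spec}(M)$ for all $\psi\in\mathrm{Spec}(N)$. A morphism $g:M\to N$ is Max-admissible if $g^*(\psi)\in\mathrm{Max}(M)$ for all $\psi\in\mathrm{Max}(N)$. *)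

(* Defs.v *)
From mathcomp Require Import all_boot.
From mathcomp Require Import boolp classical_sets.

Set Implicit Arguments.
Unset Strict Implicit.
Unset Printing Implicit Defensive.

Local Open Scope classical_set_scope.

Record signature := Signature {
  op_symbol : Type;
  arity : op_symbol -> nat
}.

Record algebra (S : signature) := Algebra {
  carrier :> Type;
  op : forall o : op_symbol S, ('I_(arity o) -> carrier) -> carrier;
  carrier_nonempty : inhabited carrier
}.

Arguments op {S} _ _ _.

Inductive term (S : signature) :=
| Var of nat
| App (o : op_symbol S) of ('I_(arity o) -> term S).

Arguments Var {S} _.

Fixpoint eval (S : signature) (M : algebra S) (e : nat -> M) (t : term S) : M :=
  match t with
  | Var n => e n
  | App o ts => op M o (fun i => eval e (ts i))
  end.

Definition satisfies (S : signature) (M : algebra S) (E : set (term S * term S)) :=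
  forall s t, E (s, t) -> forall e : nat -> M, eval e s = eval e t.

Definition equational_class (S : signature) (C : algebra S -> Prop) :=
  exists E : set (term S * term S), forall M, C M <-> satisfies M E.

Definition morphism (S : signature) (M N : algebra S) (g : M -> N) :=
  forall (o : op_symbol S) (x : 'I_(arity o) -> M),
    g (op M o x) = op N o (fun i => g (x i)).

Definition congruence (S : signature) (M : algebra S) (theta : set (M * M)) :=
  [/\ forall a, theta (a, a),
      forall a b, theta (a, b) -> theta (b, a),
      forall a b c, theta (a, b) -> theta (b, c) -> theta (a, c) &
      forall (o : op_symbol S) (x y : 'I_(arity o) -> M),
        (forall i, theta (x i, y i)) -> theta (op M o x, op M o y)].

Definition Con (S : signature) (M : algebra S) : set (set (M * M)) :=
  [set theta | congruence theta].

Definition Cg (S : signature) (M : algebra S) (X : set (M * M)) : set (M * M) :=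
  smallest (@Con S M) X.

(* The meet of two congruences is their intersection, and the top is [setT]. *)
Definition join (S : signature) (M : algebra S) (alpha beta : set (M * M)) :=
  Cg (alpha `|` beta).

Definition Max (S : signature) (M : algebra S) : set (set (M * M)) :=
  [set phi | [/\ Con phi, phi <> setT &
    forall psi, Con psi -> psi <> setT -> phi `<=` psi -> psi = phi]].

Definition congruence_modular (S : signature) (C : algebra S -> Prop) :=
  forall M, C M -> forall alpha beta gamma : set (M * M),
    Con alpha -> Con beta -> Con gamma -> alpha `<=` gamma ->
    join alpha (beta `&` gamma) = join alpha beta `&` gamma.

Definition con_image (S : signature) (M N : algebra S) (g : M -> N)
  (alpha : set (M * M)) : set (N * N) := [set (g p.1, g p.2) | p in alpha].

Definition con_preimage (S : signature) (M N : algebra S) (g : M -> N)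
  (psi : set (N * N)) : set (M * M) := [set p | psi (g p.1, g p.2)].

Definition Ker (S : signature) (M N : algebra S) (g : M -> N) : set (M * M) :=
  [set p | g p.1 = g p.2].

(* A family of binary operations on congruences. It is total on all algebras
   and all relations; only its values on congruences of members of the class
   under consideration are ever constrained or used. *)
Definition con_operations (S : signature) :=
  forall M : algebra S, set (M * M) -> set (M * M) -> set (M * M).

Definition commutator_bound (S : signature) (C : algebra S -> Prop)
    (comm : con_operations S) (M : algebra S) (alpha beta : set (M * M)) :
    set (set (M * M)) :=
  [set mu | [/\ Con mu, mu `<=` alpha `&` beta &
    forall (N : algebra S) (h : M -> N),
      C N -> morphism h -> range h = [set: N] ->
      join mu (Ker h) =
      con_preimage h (comm N (con_image h (join alpha (Ker h)))
                             (con_image h (join beta (Ker h))))]].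

(* The characterization is self-referential: [comm] also occurs in
   [commutator_bound]. It holds of the commutators of a congruence-modular
   class, but it does not pin them down by itself (the operations with constant
   value the diagonal satisfy it as well), so results about the commutators are
   to be stated for every family satisfying it. *)
Definition commutators (S : signature) (C : algebra S -> Prop)
    (comm : con_operations S) :=
  forall M, C M -> forall alpha beta : set (M * M), Con alpha -> Con beta ->
    commutator_bound C comm alpha beta (comm M alpha beta) /\
    forall mu, commutator_bound C comm alpha beta mu ->
      comm M alpha beta `<=` mu.

Definition Spec (S : signature) (comm : con_operations S) (M : algebra S) :
    set (set (M * M)) :=
  [set phi | [/\ Con phi, phi <> setT &
    forall alpha beta, Con alpha -> Con beta ->
      comm M alpha beta `<=` phi -> alpha `<=` phi \/ beta `<=` phi]].

Definition admissible (S : signature) (comm : con_operations S)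
    (M N : algebra S) (g : M -> N) :=
  forall psi, Spec comm psi -> Spec comm (con_preimage g psi).

Definition Max_admissible (S : signature) (M N : algebra S) (g : M -> N) :=
  forall psi, Max psi -> Max (con_preimage g psi).

Section Quotient.
Variables (S : signature) (M : algebra S) (theta : set (M * M)).

Definition eq_class (a : M) : set M := [set b | theta (a, b)].

Definition quotient_carrier : Type := {X : set M | range eq_class X}.

Definition quotient_proj (a : M) : quotient_carrier :=
  exist _ (eq_class a) (imageT eq_class a).

Definition quotient_repr (X : quotient_carrier) : M :=
  projT1 (cid2 (projT2 X)).

Lemma quotient_reprK X : quotient_proj (quotient_repr X) = X.
Proof.
rewrite /quotient_repr; case: X => X rX /=; case: (cid2 _) => a _ /= eaX.
by subst X; rewrite /quotient_proj; congr exist; apply: Prop_irrelevance.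
Qed.

Definition quotient_op (o : op_symbol S)
    (x : 'I_(arity o) -> quotient_carrier) : quotient_carrier :=
  quotient_proj (op M o (fun i => quotient_repr (x i))).

Lemma quotient_nonempty : inhabited quotient_carrier.
Proof. by case: (carrier_nonempty M) => a; split; apply: quotient_proj. Qed.

(* Meaningful when [theta] is a congruence, see [quotient_proj_morphism]. *)
Definition quotient : algebra S := Algebra quotient_op quotient_nonempty.

Definition proj (a : M) : quotient := quotient_proj a.

Lemma projE : Con theta -> forall a b, proj a = proj b <-> theta (a, b).
Proof.
move=> [r s t _] a b; split=> [/(congr1 sval) /= eqab | ab].
  have : eq_class b b by exact: r.
  by rewrite -eqab.
have eqab : eq_class a = eq_class b.
  apply/seteqP; split => c; last exact: t.
  by move=> ac; apply: t ac; apply: s.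
rewrite /proj /quotient_proj; move: (imageT _ a) (imageT _ b).
by rewrite eqab => p q; congr exist; apply: Prop_irrelevance.
Qed.

Lemma quotient_proj_morphism : Con theta -> morphism proj.
Proof.
move=> ct o x; apply/(projE ct); case: (ct) => _ _ _; apply => i.
by apply/(projE ct); rewrite /proj quotient_reprK.
Qed.

End Quotient.

Arguments proj {S M} theta a.

Lemma Cg_con (S : signature) (M : algebra S) (X : set (M * M)) : Con (Cg X).
Proof.
split.
- by move=> a T [[]].
- by move=> a b ab T cT; case: (cT) => -[_ s _ _] _; apply: s; apply: ab.
- move=> a b c ab bc T cT; case: (cT) => -[_ _ t _] _.
  by apply: t (bc T cT); apply: ab.
- move=> o x y xy T cT; case: (cT) => -[_ _ _ k] _.
  by apply: k => i; apply: xy.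
Qed.

(* The morphism a/theta |-> f(a)/Cg(f(theta)), computed on representatives;
   [induced_mapE] is its defining equation. *)
Definition induced_map (S : signature) (A B : algebra S) (f : A -> B)
    (theta : set (A * A)) :
    quotient theta -> quotient (Cg (con_image f theta)) :=
  fun X => proj (Cg (con_image f theta)) (f (quotient_repr X)).

Arguments induced_map {S A B} f theta _.

Lemma induced_mapE (S : signature) (A B : algebra S) (f : A -> B)
    (theta : set (A * A)) : Con theta ->
  forall a, induced_map f theta (proj theta a) =
            proj (Cg (con_image f theta)) (f a).
Proof.
move=> ct a; apply/(projE (Cg_con _)); apply: sub_gen_smallest.
exists (quotient_repr (proj theta a), a) => //.
by apply/(projE ct); rewrite /proj quotient_reprK.
Qed.

Lemma induced_map_morphism (S : signature) (A B : algebra S) (f : A -> B)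
    (theta : set (A * A)) :
  morphism f -> Con theta -> morphism (induced_map f theta).
Proof.
move=> hf ct o x; rewrite -[op _ o x]/(proj theta _) induced_mapE // hf.
by rewrite (quotient_proj_morphism (Cg_con _)).
Qed.

(* Main.v *)
(* A surjective morphism h : M -> N identifies Con(N), by preimage, with the
   congruences of M above Ker h.  Maximal congruences correspond under this
   identification, and so do prime ones, by the formula relating the commutator
   of M with that of N.  With p : A -> A/theta and
   q : B -> B/Cg(f(theta)) the projections, the square
   p^* (f_(theta)^* psi) = f^* (q^* psi) then transfers the property from f to
   each f_(theta); the converse only needs theta to be the diagonal, in which
   case every congruence of B is a preimage under q. *)
Require Import Defs.
From mathcomp Require Import all_boot.
From mathcomp Require Import boolp classical_sets.

Set Implicit Arguments.
Unset Strict Implicit.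
Unset Printing Implicit Defensive.

Local Open Scope classical_set_scope.

Lemma join_id (S : signature) (M : algebra S) (alpha beta : set (M * M)) :
  Con alpha -> beta `<=` alpha -> join alpha beta = alpha.
Proof.
move=> ca ba; apply/seteqP; split.
  by apply: smallest_sub => //; rewrite subUset; split.
by move=> p ap; apply: sub_gen_smallest; left.
Qed.

Lemma con_diagonal (S : signature) (M : algebra S) :
  Con [set p : M * M | p.1 = p.2].
Proof.
split=> [a|a b|a b c|o x y xy] //=; first by move=> ->.
by congr (op M o _); apply/funext.
Qed.

Lemma con_preimage_con (S : signature) (M N : algebra S) (g : M -> N)
    (psi : set (N * N)) :
  morphism g -> Con psi -> Con (con_preimage g psi).
Proof.
move=> hg [r s t k]; split=> [a|a b|a b c|o x y xy]; rewrite /con_preimage /=.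
- exact: r.
- exact: s.
- exact: t.
- by rewrite !hg; apply: k.
Qed.

Lemma Ker_sub_preimage (S : signature) (M N : algebra S) (g : M -> N)
    (psi : set (N * N)) : Con psi -> Ker g `<=` con_preimage g psi.
Proof. by case=> r _ _ _ [a b]; rewrite /Ker /con_preimage /= => ->. Qed.

Section Surjective.
Variables (S : signature) (M N : algebra S) (h : M -> N).
Hypotheses (hm : morphism h) (hsurj : range h = [set: N]).

Lemma surjP (b : N) : exists a, h a = b.
Proof.
by have : range h b by [rewrite hsurj]; case=> a _ <-; exists a.
Qed.

Lemma preimage_subset (gamma delta : set (N * N)) :
  con_preimage h gamma `<=` con_preimage h delta <-> gamma `<=` delta.
Proof.
split=> [gd [b c]|gd p]; last exact: gd.
by have [a <-] := surjP b; have [a' <-] := surjP c => /(gd (a, a')).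
Qed.

Lemma preimage_inj (gamma delta : set (N * N)) :
  con_preimage h gamma = con_preimage h delta -> gamma = delta.
Proof. by move=> /seteqP[gd dg]; apply/seteqP; split; apply/preimage_subset. Qed.

Lemma preimage_neqT (psi : set (N * N)) :
  con_preimage h psi <> setT <-> psi <> setT.
Proof.
split=> pT; contradict pT; first by rewrite pT.
exact: preimage_inj.
Qed.

Lemma image_preimage (gamma : set (N * N)) :
  con_image h (con_preimage h gamma) = gamma.
Proof.
apply/seteqP; split=> [_ [[a b] gab <-] //|[b c]].
have [a <-] := surjP b; have [a' <-] := surjP c => g.
by exists (a, a').
Qed.

(** If [h a = h a'] and [h b = h b'] with [(a', b')] in [alpha], then [a], [a'], [b'], [b] form a
    chain in [alpha], its outer links lying in [Ker h]. *)
Lemma preimage_image (alpha : set (M * M)) : Con alpha -> Ker h `<=` alpha ->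
  con_preimage h (con_image h alpha) = alpha.
Proof.
move=> [r s t _] ka; apply/seteqP; split=> [[a b] [[a' b'] ab /= [ea eb]]|p ap].
  apply: (t _ a'); first by apply/s/ka.
  by apply: t ab _; apply: ka.
by exists p.
Qed.

Lemma con_image_con (alpha : set (M * M)) : Con alpha -> Ker h `<=` alpha ->
  Con (con_image h alpha).
Proof.
move=> ca ka; case: (ca) => r s t k; split.
- by move=> b; have [a <-] := surjP b; exists (a, a).
- by move=> _ _ [[a b] ab [<- <-]]; exists (b, a) => //; apply: s.
- move=> b c d; have [a <-] := surjP b; have [a' <-] := surjP c.
  have [a'' <-] := surjP d.
  (* Two image pairs meeting at [h a'] may come from pairs of [alpha] with different middle entries;
     since [alpha] contains [Ker h], membership does not depend on the representatives. *)
  have E x y : con_image h alpha (h x, h y) <-> alpha (x, y).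
    by rewrite -[in X in _ <-> X](preimage_image ca ka).
  by move=> /E ab /E bc; apply/E; apply: t ab bc.
- move=> o x y xy.
  have {}xy i : exists p : M * M, alpha p /\ (h p.1, h p.2) = (x i, y i).
    by have [p ap ep] := xy i; exists p.
  have [p pP] := choice xy.
  exists (op M o (fun i => (p i).1), op M o (fun i => (p i).2)) => /=.
    by apply: k => i; rewrite -surjective_pairing; have [] := pP i.
  rewrite !hm; congr (op N o _, op N o _); apply/funext => i.
    by have [_ [-> _]] := pP i.
  by have [_ [_ ->]] := pP i.
Qed.

Lemma Max_preimage (psi : set (N * N)) : Con psi ->
  Max (con_preimage h psi) <-> Max psi.
Proof.
move=> cpsi; split=> [[_ /preimage_neqT pT pmax]|[_ pT pmax]].
  split=> // chi cchi /preimage_neqT chiT /preimage_subset pchi.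
  by apply: preimage_inj; apply: pmax => //; apply: con_preimage_con.
split=> [||chi cchi chiT pchi]; first exact: con_preimage_con.
  exact/preimage_neqT.
(* Any competitor [chi] above the preimage of [psi] contains [Ker h], so it is itself a preimage and
   can be compared with [psi] inside [N]. *)
have kchi : Ker h `<=` chi by apply: subset_trans pchi; apply: Ker_sub_preimage.
rewrite -(preimage_image cchi kchi) in chiT pchi *.
by rewrite (pmax (con_image h chi)) //; [exact: con_image_con|
   exact/preimage_neqT|exact/preimage_subset].
Qed.

Lemma Spec_preimage (C : algebra S -> Prop) (comm : con_operations S)
    (psi : set (N * N)) : C M -> C N -> commutators C comm -> Con psi ->
  Spec comm (con_preimage h psi) <-> Spec comm psi.
Proof.
move=> CM CN commP cpsi.
have formula alpha beta : Con alpha -> Con beta ->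
    join (comm M alpha beta) (Ker h) =
    con_preimage h (comm N (con_image h (join alpha (Ker h)))
                           (con_image h (join beta (Ker h)))).
  by move=> ca cb; have [[_ _ E] _] := commP M CM _ _ ca cb; exact: E.
split=> [[_ /preimage_neqT pT pP]|[_ pT pP]].
  split=> // gamma delta cg cd gd.
  have cg' := con_preimage_con hm cg; have cd' := con_preimage_con hm cd.
  suff /(pP _ _ cg' cd')[] :
      comm M (con_preimage h gamma) (con_preimage h delta) `<=`
      con_preimage h psi.
  - by move=> /preimage_subset; left.
  - by move=> /preimage_subset; right.
  (* Preimages already contain [Ker h], so the joins on the right collapse and the formula reads
     $[h^*\gamma,h^*\delta]_M\vee\mathrm{Ker}(h)=h^*([\gamma,\delta]_N)$. *)
  move: (formula _ _ cg' cd').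
  rewrite (join_id cg') ?(join_id cd'); try exact: Ker_sub_preimage.
  rewrite !image_preimage => E p cp.
  apply: (preimage_subset _ _).2 gd _ _; rewrite -E.
  by apply: sub_gen_smallest; left.
split=> [||alpha beta ca cb ab]; first exact: con_preimage_con.
  exact/preimage_neqT.
have Kjoin gamma : Ker h `<=` join gamma (Ker h).
  by move=> p kp; apply: sub_gen_smallest; right.
have image_sub gamma : con_image h (join gamma (Ker h)) `<=` psi ->
    gamma `<=` con_preimage h psi.
  move=> gp p gp'; apply: gp; exists p => //.
  by apply: sub_gen_smallest; left.
(* Enlarging [alpha] and [beta] by [Ker h] makes their images congruences of [N]. By the formula,
   the commutator of these images pulls back to $[\alpha,\beta]_M\vee\mathrm{Ker}(h)$, and both
   joinands lie below the preimage of [psi]. *)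
have [||||] := pP (con_image h (join alpha (Ker h)))
                  (con_image h (join beta (Ker h))).
- by apply: con_image_con => //; apply: Cg_con.
- by apply: con_image_con => //; apply: Cg_con.
- apply/preimage_subset; rewrite -formula //.
  apply: smallest_sub; first exact: con_preimage_con.
  by rewrite subUset; split=> //; apply: Ker_sub_preimage.
- by left; apply: image_sub.
- by right; apply: image_sub.
Qed.

Lemma eval_morphism (e : nat -> M) (t : term S) :
  h (eval e t) = eval (h \o e) t.
Proof.
elim: t => [n|o ts IH] //=; rewrite hm; congr (op N o _).
by apply/funext => i; apply: IH.
Qed.

(** Every valuation in [N] lifts along [h] to one in [M], where the identities hold. This puts the
    quotients of [A] and [B] in the class, so that the commutator formula applies to their
    projections. *)
Lemma equational_class_image (C : algebra S -> Prop) :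
  equational_class C -> C M -> C N.
Proof.
move=> [E CE] /CE ME; apply/CE => s t Est e.
have [e' he'] := choice (fun n => surjP (e n)).
have -> : e = h \o e' by apply/funext => n; rewrite /= he'.
by rewrite -!eval_morphism (ME _ _ Est).
Qed.

End Surjective.

Lemma proj_surj (S : signature) (M : algebra S) (theta : set (M * M)) :
  range (proj theta) = [set: quotient theta].
Proof.
apply/seteqP; split=> // X _.
by exists (quotient_repr X) => //; apply: quotient_reprK.
Qed.

Lemma Ker_proj (S : signature) (M : algebra S) (theta : set (M * M)) :
  Con theta -> Ker (proj theta) = theta.
Proof. by move=> ct; apply/seteqP; split=> -[a b] /(projE ct). Qed.

Lemma preimage_induced_map (S : signature) (A B : algebra S) (f : A -> B)
    (theta : set (A * A)) psi : Con theta ->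
  con_preimage (proj theta) (con_preimage (induced_map f theta) psi) =
  con_preimage f (con_preimage (proj (Cg (con_image f theta))) psi).
Proof.
by move=> ct; apply/funext => -[a b]; rewrite /con_preimage /= !induced_mapE.
Qed.

(** The predicate [P] stands for [Spec] or [Max], so both equivalences share one argument. Transfer
    along projections is only asked for [A] and [B], which are known to lie in the class. *)
Lemma preserve_preimage_induced_map (S : signature)
    (P : forall M : algebra S, set (set (M * M))) (A B : algebra S)
    (f : A -> B) (hf : morphism f) :
  (forall (M : algebra S) (psi : set (M * M)), P M psi -> Con psi) ->
  (forall M : algebra S, M = A \/ M = B -> forall (theta : set (M * M)) psi,
     Con theta -> Con psi ->
     P M (con_preimage (proj theta) psi) <-> P (quotient theta) psi) ->
  ((forall psi, P B psi -> P A (con_preimage f psi)) <->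
   forall theta : set (A * A), Con theta -> forall psi,
     P (quotient (Cg (con_image f theta))) psi ->
     P (quotient theta) (con_preimage (induced_map f theta) psi)).
Proof.
move=> Pcon Pproj; split=> [fP theta ct psi Ppsi|fP psi Ppsi].
  have cq := Cg_con (con_image f theta); have cpsi := Pcon _ _ Ppsi.
  apply/(Pproj A) => //; first by left.
    by apply: con_preimage_con => //; apply: induced_map_morphism.
  by rewrite preimage_induced_map //; apply: fP; apply/Pproj => //; right.
have cpsi := Pcon _ _ Ppsi.
set D := [set p : A * A | p.1 = p.2]; have cD : Con D := con_diagonal A.
set q := proj (Cg (con_image f D)).
have cq : Con (Cg (con_image f D)) := Cg_con _.
have qm : morphism q := quotient_proj_morphism cq.
(* The image of the diagonal of [A] consists of diagonal pairs of [B], so the congruence it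
   generates lies below every congruence of [B]. *)
have kq : Ker q `<=` psi.
  rewrite Ker_proj //; apply: smallest_sub => // _ [[a b] ab <-] /=.
  by have -> : a = b := ab; case: cpsi.
have qs : range q = setT := proj_surj _.
have epsi := preimage_image cpsi kq.
have cpsi' := con_image_con qm qs cpsi kq.
(* Once [psi] is written as a preimage under [q], the commuting square turns its preimage under [f]
   into one along the projection of [A]. *)
rewrite -epsi -preimage_induced_map //.
apply/(Pproj A) => //; first by left.
  by apply: con_preimage_con => //; apply: induced_map_morphism.
by apply: fP => //; apply/(Pproj B); [right|..]; rewrite ?epsi.
Qed.

Theorem proposition8p9 (S : signature) (C : algebra S -> Prop)
    (hC : equational_class C) (A B : algebra S) (hA : C A) (hB : C B)
    (f : A -> B) (hf : morphism f) :
  (congruence_modular C ->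
     forall comm : con_operations S, commutators C comm ->
       (admissible comm f <->
        forall theta : set (A * A), Con theta ->
          admissible comm (induced_map f theta)))
  /\
  (Max_admissible f <->
   (forall theta : set (A * A), Con theta ->
      Max_admissible (induced_map f theta))).
Proof.
split=> [_ comm commP|].
  rewrite /admissible.
  apply: (preserve_preimage_induced_map (P := @Spec S comm) hf).
    by move=> M psi [].
  move=> M MAB theta psi ct cpsi.
  have CM : C M by case: MAB => ->.
  have pm := quotient_proj_morphism ct; have ps := proj_surj theta.
  have CQ := equational_class_image pm ps hC CM.
  exact: (Spec_preimage pm ps CM CQ commP cpsi).
rewrite /Max_admissible.
apply: (preserve_preimage_induced_map (P := @Max S) hf).
  by move=> M psi [].
move=> M _ theta psi ct cpsi.
exact: (Max_preimage (quotient_proj_morphism ct) (proj_surj theta) cpsi).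
Qed.
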